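(* No tournament on $11$ vertices has the disjoint linking property (as a directed graph).
   Context: A tournament on $k$ vertices is a directed graph on $k$ vertices with exactly one directed edge between each pair of distinct vertices (equivalently, the complete graph $K_k$ with a choice of orientation of each edge). Embeddings are embeddings of the graph in $S^3$, in the usual (tame) sense of spatial graph theory. A cycle in a directed graph means a cycle of the underlying undirected graph; it is consistently oriented if its edges all point the same way around the cycle (i.e. it is a directed cycle). A directed graph $G$ has the disjoint linking property if every embedding of $G$ in $S^3$ contains a disjoint pair of links, i.e. two non-split links, each with at least two components, such that all components of both links are consistently oriented cycles of $G$ and all these cycles are pairwise disjoint. *)

(* Defs.v *)
From HB Require Import structures.
From mathcomp Require Export all_boot all_order all_algebra.
From mathcomp Require Export all_classical all_reals all_analysis.
Export numFieldNormedType.Exports.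

Set Implicit Arguments.
Unset Strict Implicit.
Unset Printing Implicit Defensive.

Import Order.TTheory GRing.Theory Num.Theory.
Local Open Scope classical_set_scope.
Local Open Scope ring_scope.

(* A directed graph on a finite vertex set V is its edge relation e : rel V,
   with e x y meaning that there is an edge from x to y.                      *)
Definition tournament (V : finType) (e : rel V) : Prop :=
  irreflexive e /\ forall x y : V, x != y -> e x y (+) e y x.

(* A consistently oriented cycle is listed in cyclic order, without repetition. *)
Definition directed_cycle (V : finType) (e : rel V) (c : seq V) : Prop :=
  c <> [::] /\ ucycle e c.

Section Topology.
Variable R : realType.

Definition sphere (n : nat) : set 'rV[R]_n.+1 :=
  [set x | \sum_i x 0 i ^+ 2 = 1].

Definition homeomorphism (T U : topologicalType) (A : set T) (B : set U)
    (h : T -> U) : Prop :=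
  exists g : U -> T,
    [/\ set_fun A B h, set_fun B A g,
        (forall x, A x -> g (h x) = x), (forall y, B y -> h (g y) = y) &
        {within A, continuous h} /\ {within B, continuous g}].

Definition convex_hull (n : nat) (s : seq 'rV[R]_n) : set 'rV[R]_n :=
  [set x | exists w : 'I_(size s) -> R,
     [/\ forall i, 0 <= w i, \sum_i w i = 1 & x = \sum_i w i *: s`_i]].

Definition polyhedron (n : nat) (P : set 'rV[R]_n) : Prop :=
  exists ss : seq (seq 'rV[R]_n),
    P = \bigcup_(s in [set` ss]) convex_hull s.

(* Tameness of a proper compact subset X of S^3, in the classical sense: some
   homeomorphism of S^3 carries X onto a polyhedron.  The piecewise linear
   structure of S^3 is that of R^3 seen as the complement of a point, and a
   homeomorphism from S^3 minus p onto R^3 always extends over p.             *)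
Definition tame (X : set 'rV[R]_4) : Prop :=
  exists (p : 'rV[R]_4) (h : 'rV[R]_4 -> 'rV[R]_3),
    [/\ sphere p, X `<=` @sphere 3 `\ p,
        homeomorphism (@sphere 3 `\ p) [set: 'rV[R]_3] h &
        polyhedron (h @` X)].

Definition tame_2sphere (S : set 'rV[R]_4) : Prop :=
  tame S /\
  exists f : 'rV[R]_3 -> 'rV[R]_4, homeomorphism (@sphere 2) S f.

(* A link is given by the list of its components.  It is split if a 2-sphere in
   its complement has at least one component of the link on each side.        *)
Definition split_link (L : seq (set 'rV[R]_4)) : Prop :=
  exists S : set 'rV[R]_4,
    [/\ tame_2sphere S,
        (forall K : set 'rV[R]_4, K \in L -> K `&` S = set0) &
        exists K1 K2 : set 'rV[R]_4, [/\ K1 \in L, K2 \in L &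
          exists x y : 'rV[R]_4,
            [/\ K1 `<=` connected_component (@sphere 3 `\` S) x,
                K2 `<=` connected_component (@sphere 3 `\` S) y &
                ~ connected_component (@sphere 3 `\` S) x y]]].

End Topology.

Section SpatialGraph.
Variables (R : realType) (V : finType) (e : rel V).

Definition edge_curve (arc : V -> V -> R -> 'rV[R]_4) (x y : V) :
    set 'rV[R]_4 := arc x y @` `[0, 1].

(* [point] places the vertices; [arc x y], restricted to [0, 1], parametrizes
   the edge from x to y and is irrelevant when e x y does not hold.           *)
Record embedding := Embedding {
  point : V -> 'rV[R]_4;
  arc : V -> V -> R -> 'rV[R]_4;
  point_sphere : forall x, sphere (point x);
  point_inj : injective point;
  arc_sphere : forall x y, e x y -> edge_curve arc x y `<=` @sphere R 3;
  arc_continuous : forall x y, e x y -> {within `[0, 1], continuous (arc x y)};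
  arc0 : forall x y, e x y -> arc x y 0 = point x;
  arc1 : forall x y, e x y -> arc x y 1 = point y;
  arc_point : forall x y z (t : R), e x y -> t \in `]0, 1[ -> arc x y t <> point z;
  arc_inj : forall x y x' y' (t t' : R), e x y -> e x' y' ->
    t \in `]0, 1[ -> t' \in `]0, 1[ ->
    arc x y t = arc x' y' t' -> [/\ x = x', y = y' & t = t'];
  embedding_tame : tame (range point `|`
    \bigcup_(xy in [set xy : V * V | e xy.1 xy.2]) edge_curve arc xy.1 xy.2)
}.

Definition cycle_curve (f : embedding) (c : seq V) : set 'rV[R]_4 :=
  \bigcup_(x in [set` c]) edge_curve (arc f) x (next c x).

Definition disjoint_cycles (c d : seq V) : bool := ~~ has (mem c) d.

(* L1 and L2 list the cycles that are the components of the two links. *)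
Definition disjoint_pair_of_links (f : embedding) (L1 L2 : seq (seq V)) : Prop :=
  [/\ (forall c, c \in L1 ++ L2 -> directed_cycle e c),
      pairwise disjoint_cycles (L1 ++ L2),
      (2 <= size L1)%N /\ (2 <= size L2)%N,
      ~ split_link (map (cycle_curve f) L1) &
      ~ split_link (map (cycle_curve f) L2)].

Definition disjoint_linking_property : Prop :=
  forall f : embedding, exists L1 L2 : seq (seq V),
    disjoint_pair_of_links f L1 L2.

End SpatialGraph.

(* Main.v *)
(** Four pairwise disjoint directed cycles of a tournament need at least twelve
vertices, so on eleven vertices no embedding contains a disjoint pair of links.
It remains to see that an embedding exists: put the vertices on the moment curve
of R^3, join them by straight segments, and transport the resulting polyhedron
to the sphere by the inverse stereographic projection. *)
Require Import Defs.
From mathcomp Require Import ring lra.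

Set Implicit Arguments.
Unset Strict Implicit.
Unset Printing Implicit Defensive.

Import Order.TTheory GRing.Theory Num.Theory.
Local Open Scope classical_set_scope.
Local Open Scope ring_scope.

(** * Stereographic projection *)

(** A neighbourhood of a row vector contains a product of neighbourhoods of its finitely many
    entries. *)
Lemma continuous_row (T : topologicalType) (R : realType) (n : nat)
    (f : T -> 'rV[R]_n) (x : T) :
  (forall i, f y 0 i @[y --> x] --> f x 0 i) -> {for x, continuous f}.
Proof.
move=> fx A [P Px PA].
have : \forall y \near x, forall i, P 0 i (f y 0 i).
  by apply: filter_forall => i; apply: fx; apply: Px.
apply: filterS => y Py; apply: PA => i j.
by rewrite (ord1 i).
Qed.

Definition sqnorm (R : realType) (n : nat) (u : 'rV[R]_n) : R :=
  \sum_i u 0 i ^+ 2.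

(** Projection from the pole [north], the axis being the last coordinate; at the pole itself
    division by zero yields the default value 0. *)
Definition stereo (R : realType) (n : nat) (x : 'rV[R]_n.+1) : 'rV[R]_n :=
  \row_i (x 0 (lift ord_max i) / (1 - x 0 ord_max)).

Definition stereo_inv (R : realType) (n : nat) (u : 'rV[R]_n) : 'rV[R]_n.+1 :=
  \row_j (if unlift ord_max j is Some i then 2 * u 0 i / (1 + sqnorm u)
          else (sqnorm u - 1) / (1 + sqnorm u)).

Definition north (R : realType) (n : nat) : 'rV[R]_n.+1 := delta_mx 0 ord_max.

Lemma sqnorm_ge0 (R : realType) (n : nat) (u : 'rV[R]_n) : 0 <= sqnorm u.
Proof. by apply: sumr_ge0 => i _; apply: sqr_ge0. Qed.

Lemma sqnorm1_neq0 (R : realType) (n : nat) (u : 'rV[R]_n) : 1 + sqnorm u != 0.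
Proof. by apply: lt0r_neq0; have := sqnorm_ge0 u; lra. Qed.

Lemma sqnorm_last (R : realType) (n : nat) (x : 'rV[R]_n.+1) :
  sqnorm x = x 0 ord_max ^+ 2 + \sum_i x 0 (lift ord_max i) ^+ 2.
Proof. by rewrite /sqnorm (bigD1_ord ord_max). Qed.

Lemma stereo_inv_max (R : realType) (n : nat) (u : 'rV[R]_n) :
  stereo_inv u 0 ord_max = (sqnorm u - 1) / (1 + sqnorm u).
Proof. by rewrite mxE unlift_none. Qed.

Lemma stereo_inv_lift (R : realType) (n : nat) (u : 'rV[R]_n) (i : 'I_n) :
  stereo_inv u 0 (lift ord_max i) = 2 * u 0 i / (1 + sqnorm u).
Proof. by rewrite mxE liftK. Qed.

Lemma sphere_stereo_inv (R : realType) (n : nat) (u : 'rV[R]_n) :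
  sphere (stereo_inv u).
Proof.
have q0 := sqnorm1_neq0 u.
rewrite /sphere /= -/(sqnorm (stereo_inv u)) sqnorm_last stereo_inv_max.
under eq_bigr do rewrite stereo_inv_lift -mulrA mulrCA exprMn.
rewrite -mulr_suml -/(sqnorm u).
(* With q = [sqnorm u], this is (q - 1)^2 + 4q = (1 + q)^2. *)
by field.
Qed.

Lemma sphere_north (R : realType) (n : nat) : sphere (north R n).
Proof.
rewrite /sphere /= -/(sqnorm (north R n)) sqnorm_last big1 => [|i _].
  by rewrite mxE !eqxx expr1n addr0.
by rewrite mxE [lift _ _ == _]eq_sym (negbTE (neq_lift _ _)) andbF expr0n.
Qed.

Lemma stereo_inv_neq_north (R : realType) (n : nat) (u : 'rV[R]_n) :
  stereo_inv u <> north R n.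
Proof.
have q0 := sqnorm1_neq0 u.
move/matrixP/(_ 0 ord_max); rewrite stereo_inv_max mxE !eqxx.
(* A last coordinate equal to 1 would force q - 1 = 1 + q for q = [sqnorm u]. *)
by move/(canRL (divfK q0)) => /=; lra.
Qed.

(** If the last coordinate is 1, the squares of the others sum to 0, so all of them vanish and the
    point is the pole. *)
Lemma sphere_max_neq1 (R : realType) (n : nat) (x : 'rV[R]_n.+1) :
  sphere x -> x <> north R n -> 1 - x 0 ord_max != 0.
Proof.
move=> sx; apply: contra_notN; rewrite subr_eq0 eq_sym => /eqP x1.
move: sx; rewrite /sphere /= -/(sqnorm x) sqnorm_last x1 expr1n => /eqP.
rewrite -subr_eq0 addrAC subrr add0r psumr_eq0 => [/allP x0|i _]; last first.
  exact: sqr_ge0.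
apply/rowP => j; rewrite mxE eqxx /=; case: (unliftP ord_max j) => [i ->|->].
  have /= := x0 i (mem_index_enum _).
  by rewrite sqrf_eq0 [lift _ _ == _]eq_sym (negbTE (neq_lift _ _)) => /eqP.
by rewrite eqxx x1.
Qed.

Lemma stereo_invK (R : realType) (n : nat) : cancel (@stereo_inv R n) (@stereo R n).
Proof.
move=> u; have q0 := sqnorm1_neq0 u.
apply/rowP => i; rewrite mxE stereo_inv_lift stereo_inv_max.
field; rewrite q0 /=.
by apply/eqP; lra.
Qed.

Lemma stereoK (R : realType) (n : nat) (x : 'rV[R]_n.+1) :
  sphere x -> x <> north R n -> stereo_inv (stereo x) = x.
Proof.
move=> sx xN; have z0 := sphere_max_neq1 sx xN.
(* On the sphere the other squares sum to 1 - z^2, where z is the last coordinate; one factor 1 - z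
   cancels. *)
have q_x : sqnorm (stereo x) = (1 + x 0 ord_max) / (1 - x 0 ord_max).
  rewrite /sqnorm.
  under eq_bigr do rewrite mxE exprMn.
  rewrite -mulr_suml.
  move: sx; rewrite /sphere /= -/(sqnorm x) sqnorm_last => /(canRL (addKr _)) ->.
  by field.
apply/rowP => j; case: (unliftP ord_max j) => [i ->|->].
  rewrite stereo_inv_lift q_x mxE; field; rewrite z0 /=.
  by apply/eqP; lra.
rewrite stereo_inv_max q_x; field; rewrite z0 /=.
by apply/eqP; lra.
Qed.

Lemma continuous_sqnorm (R : realType) (n : nat) : continuous (@sqnorm R n).
Proof.
apply: continuous_big => [|i _ u]; first exact: add_continuous.
have ui : v 0 i @[v --> u] --> u 0 i by exact: coord_continuous.
exact: (cvgM ui ui).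
Qed.

Lemma continuous_stereo_inv (R : realType) (n : nat) :
  continuous (@stereo_inv R n).
Proof.
move=> u; apply: continuous_row => j.
have q1 : {for u, continuous (fun v => (1 + sqnorm v)^-1)}.
  apply: continuousV; first exact: sqnorm1_neq0.
  by apply: (@continuousD R R^o); [exact: cst_continuous | exact: continuous_sqnorm].
case: (unliftP ord_max j) => [i ->|->].
  rewrite stereo_inv_lift; under eq_fun do rewrite stereo_inv_lift.
  have num : {for u, continuous (fun v : 'rV[R]_n => 2 * v 0 i)}.
    by apply: continuousM; [exact: cst_continuous | exact: coord_continuous].
  exact: (continuousM num q1).
rewrite stereo_inv_max; under eq_fun do rewrite stereo_inv_max.
have num : {for u, continuous (fun v : 'rV[R]_n => sqnorm v - 1)}.
  by apply: (@continuousB R R^o); [exact: continuous_sqnorm | exact: cst_continuous].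
exact: (continuousM num q1).
Qed.

Lemma continuous_stereo (R : realType) (n : nat) (x : 'rV[R]_n.+1) :
  1 - x 0 ord_max != 0 -> {for x, continuous (@stereo R n)}.
Proof.
move=> x1; apply: continuous_row => i.
rewrite mxE; under eq_fun do rewrite mxE.
have den : {for x, continuous (fun y : 'rV[R]_n.+1 => (1 - y 0 ord_max)^-1)}.
  apply: continuousV => //.
  by apply: (@continuousB R R^o); [exact: cst_continuous | exact: coord_continuous].
by apply: cvgM den; exact: coord_continuous.
Qed.

Lemma homeomorphism_stereo (R : realType) (n : nat) :
  homeomorphism (@sphere R n `\ north R n) [set: 'rV[R]_n] (@stereo R n).
Proof.
exists (@stereo_inv R n); split=> //.
- by move=> u _; split; [exact: sphere_stereo_inv | exact: stereo_inv_neq_north].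
- by move=> x [sx xN]; exact: stereoK.
- by move=> u _; exact: stereo_invK.
split.
  apply: continuous_in_subspaceT => x /set_mem[sx xN].
  by apply: continuous_stereo; exact: sphere_max_neq1.
by apply: continuous_subspaceT; exact: continuous_stereo_inv.
Qed.

(** [stereo] itself is the required homeomorphism: it carries the image of [P] back to [P]. *)
Lemma tame_stereo_inv (R : realType) (P : set 'rV[R]_3) :
  polyhedron P -> tame (@stereo_inv R 3 @` P).
Proof.
move=> polyP; exists (north R 3), (@stereo R 3); split.
- exact: sphere_north.
- by move=> _ [u _ <-]; split;
    [exact: sphere_stereo_inv | exact: stereo_inv_neq_north].
- exact: homeomorphism_stereo.
rewrite image_comp (_ : _ \o _ = id) ?image_id //.
by apply/funext => u; exact: stereo_invK.
Qed.

(** * Straight segments and chords of the moment curve *)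

Definition segment (R : realType) (n : nat) (u v : 'rV[R]_n) (t : R) : 'rV[R]_n :=
  (1 - t) *: u + t *: v.

Lemma continuous_segment (R : realType) (n : nat) (u v : 'rV[R]_n) :
  continuous (segment u v).
Proof.
move=> t; apply: continuous_row => i.
rewrite !mxE; under eq_fun do rewrite !mxE.
have id_t : {for t, continuous (@idfun R)} by exact: cvg_id.
have cst_t (c : R) : {for t, continuous (fun=> c)} by exact: cst_continuous.
have id1_t : {for t, continuous (fun s : R => 1 - s)}.
  by apply: (@continuousB R R^o); [exact: cst_t | exact: id_t].
exact: (@continuousD R R^o _ _ _ _ (continuousM id1_t (cst_t _))
  (continuousM id_t (cst_t _))).
Qed.

Lemma convex_hull1 (R : realType) (n : nat) (u : 'rV[R]_n) :
  convex_hull [:: u] = [set u].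
Proof.
apply/seteqP; split=> [x [w [_]]|_ ->].
  by rewrite !big_ord_recl !big_ord0 !addr0 /= => -> ->; rewrite scale1r.
exists (fun=> 1); split=> [i||]; first exact: ler01.
  by rewrite big_ord_recl big_ord0 addr0.
by rewrite big_ord_recl big_ord0 addr0 scale1r.
Qed.

Lemma convex_hull2 (R : realType) (n : nat) (u v : 'rV[R]_n) :
  convex_hull [:: u; v] = segment u v @` `[0, 1].
Proof.
apply/seteqP; split=> [x [w [w_ge0]]|_ [t t01 <-]].
  rewrite !big_ord_recl !big_ord0 !addr0 /= => w1 ->.
  (* The parameter along the segment is the weight of the second end point. *)
  exists (w (lift ord0 ord0)); last by rewrite /segment -w1 addrK.
  rewrite /= in_itv /= w_ge0 -w1 lerDr; exact: w_ge0.
move: t01; rewrite /= in_itv /= => /andP[t0 t1].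
exists (fun i => if i == ord0 then 1 - t else t); split=> [i||].
- by case: ifP => _; rewrite ?subr_ge0.
- by rewrite !big_ord_recl !big_ord0 /= addr0 subrK.
- by rewrite !big_ord_recl !big_ord0 /= addr0.
Qed.

Definition moment (R : realType) (n : nat) (a : R) : 'rV[R]_n :=
  \row_i a ^+ i.+1.

Lemma segment_moment (R : realType) (n : nat) (a b t : R) (i : 'I_n) :
  segment (moment n a) (moment n b) t 0 i
  = (1 - t) * a ^+ i.+1 + t * b ^+ i.+1.
Proof. by rewrite !mxE. Qed.

Lemma moment_inj (R : realType) (n : nat) : injective (@moment R n.+1).
Proof. by move=> a b /rowP/(_ ord0); rewrite !mxE. Qed.

(** The first two coordinates of the curve trace a parabola, and strict convexity keeps the interior
    of a chord off it. *)
Lemma segment_moment_neq (R : realType) (n : nat) (a b c t : R) :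
  a != b -> t \in `]0, 1[ ->
  segment (moment n.+2 a) (moment n.+2 b) t <> moment n.+2 c.
Proof.
rewrite in_itv /= => ab /andP[t0 t1] /rowP E.
pose D k := (1 - t) * a ^+ k + t * b ^+ k - c ^+ k.
have D0 (i : 'I_n.+2) : D i.+1 = 0.
  by apply/eqP; rewrite subr_eq0 -segment_moment E mxE.
have [D1 D2] := (D0 ord0, D0 (lift ord0 ord0)).
(* This is the height of the chord above the parabola; with m = (1 - t) a + t b, subtracting (m + c)
   (m - c) from [D 2] replaces c^2 by m^2. *)
have : (1 - t) * t * (a - b) ^+ 2 = 0.
  transitivity (D 2 - ((1 - t) * a + t * b + c) * D 1); first by rewrite /D; ring.
  by rewrite D1 D2 mulr0 subr0.
apply/eqP; rewrite !mulf_neq0 ?sqrf_eq0 ?subr_eq0 //.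
- by rewrite eq_sym lt_eqF.
- by rewrite gt_eqF.
Qed.

(* Four points of the moment curve are affinely independent, so the two segments
   must share their end points. *)
Lemma segment_moment_inj (R : realType) (a b a' b' t t' : R) :
  a != b -> t \in `]0, 1[ -> t' \in `]0, 1[ ->
  segment (moment 3 a) (moment 3 b) t = segment (moment 3 a') (moment 3 b') t' ->
  [/\ a = a', b = b' & t = t'] \/ a = b' /\ b = a'.
Proof.
rewrite !in_itv /= => ab /andP[t0 t1] /andP[t'0 t'1] /rowP E.
pose D k := (1 - t) * a ^+ k + t * b ^+ k - ((1 - t') * a' ^+ k + t' * b' ^+ k).
have D0 (i : 'I_3) : D i.+1 = 0.
  by apply/eqP; rewrite subr_eq0 -!(segment_moment _ _ _ i) E.
have [D1 D2 D3] := And3 (D0 ord0) (D0 (lift ord0 ord0)) (D0 ord_max).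
rewrite /= in D1 D2 D3.
(* Test the equality of the two points against the cubic (X - a') (X - b') (X - b), which kills
   every term but that of a. Its constant term drops out because both pairs of weights sum to 1. *)
have a_end : (1 - t) * ((a - b) * ((a - a') * (a - b'))) = 0.
  transitivity (D 3 - (a' + b' + b) * D 2 + (a' * b' + a' * b + b' * b) * D 1).
    by rewrite /D; ring.
  by rewrite D1 D2 D3 !mulr0 subr0 addr0.
have b_end : t * ((b - a) * ((b - a') * (b - b'))) = 0.
  transitivity (D 3 - (a' + b' + a) * D 2 + (a' * b' + a' * a + b' * a) * D 1).
    by rewrite /D; ring.
  by rewrite D1 D2 D3 !mulr0 subr0 addr0.
move/eqP: a_end; rewrite !mulf_eq0 !subr_eq0 (negbTE ab) (gt_eqF t1) /= => aa.
move/eqP: b_end; rewrite !mulf_eq0 !subr_eq0 [b == a]eq_sym (negbTE ab) (gt_eqF t0) /=.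
(* Each of a and b is one of a', b'; as a and b differ, they match in one of the two orders. *)
case/orP: aa => /eqP aa /orP[]/eqP ba; [by rewrite ba aa eqxx in ab| |by right|].
- left; split=> //; apply/eqP; rewrite -subr_eq0.
  have /eqP : (t - t') * (b - a) = 0 by rewrite -D1 /D -aa -ba; ring.
  by rewrite mulf_eq0 [b - a == 0]subr_eq0 [b == a]eq_sym (negbTE ab) orbF.
- by rewrite ba aa eqxx in ab.
Qed.

(** Vertices give one-point hulls and edges two-point hulls; both lists are finite because [V]
    is. *)
Lemma polyhedron_segments (R : realType) (n : nat) (V : finType) (e : rel V)
    (p : V -> 'rV[R]_n) :
  polyhedron (range p `|`
    \bigcup_(xy in [set xy : V * V | e xy.1 xy.2])
      segment (p xy.1) (p xy.2) @` `[0, 1]).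
Proof.
exists ([seq [:: p x] | x <- enum V] ++
  [seq [:: p xy.1; p xy.2] | xy <- enum [pred xy : V * V | e xy.1 xy.2]]).
apply/seteqP; split=> u.
  case=> [[x _ <-]|[xy exy pu]].
    exists [:: p x]; last by rewrite convex_hull1.
    by rewrite /= mem_cat map_f // mem_enum.
  exists [:: p xy.1; p xy.2]; last by rewrite convex_hull2.
  by rewrite /= mem_cat orbC map_f // mem_enum.
case=> s; rewrite /= mem_cat => /orP[]/mapP[].
  by move=> x _ ->; rewrite convex_hull1 => ->; left; exists x.
move=> xy; rewrite mem_enum => exy ->; rewrite convex_hull2 => pu.
by right; exists xy.
Qed.

(** * A tame straight-line embedding *)

Definition moment_point (R : realType) (V : finType) (x : V) : 'rV[R]_3 :=
  moment 3 (enum_rank x)%:R.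

Lemma enum_rank_natr_inj (R : realType) (V : finType) :
  injective (fun x : V => (enum_rank x)%:R : R).
Proof.
by move=> x y /eqP; rewrite eqr_nat => /eqP /val_inj /enum_rank_inj.
Qed.

(** Asymmetry excludes loops, whose segment would be a single point, and pairs of opposite edges,
    which would share one segment. *)
Lemma embedding_exists (R : realType) (V : finType) (e : rel V) :
  (forall x y, e x y -> ~~ e y x) -> inhabited (embedding R e).
Proof.
move=> asym; pose p := @moment_point R V.
have neq x y : e x y -> (enum_rank x)%:R != (enum_rank y)%:R :> R.
  move=> exy; rewrite (inj_eq (@enum_rank_natr_inj R V)).
  by apply: contraTneq exy => <-; apply/negP => exx; have := asym _ _ exx; rewrite exx.
split; apply: (@Embedding R V e (fun x => stereo_inv (p x))
  (fun x y t => stereo_inv (segment (p x) (p y) t))).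
- by move=> x; exact: sphere_stereo_inv.
- by move=> x y /(can_inj (@stereo_invK R 3))/moment_inj/enum_rank_natr_inj.
- by move=> x y _ _ [t _ <-]; exact: sphere_stereo_inv.
- move=> x y _; apply: continuous_subspaceT => t.
  by apply: continuous_comp; [exact: continuous_segment | exact: continuous_stereo_inv].
- by move=> x y _; rewrite /segment subr0 scale1r scale0r addr0.
- by move=> x y _; rewrite /segment subrr scale1r scale0r add0r.
- move=> x y z t exy t01 /(can_inj (@stereo_invK R 3)).
  by apply: segment_moment_neq => //; exact: neq.
- move=> x y x' y' t t' exy exy' t01 t01' /(can_inj (@stereo_invK R 3)).
  move=> /(segment_moment_inj (neq _ _ exy) t01 t01').
  case=> [[/enum_rank_natr_inj xx' /enum_rank_natr_inj yy' ->] //|].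
  (* The same segment run backwards would need the opposite edge. *)
  move=> [/enum_rank_natr_inj xy' /enum_rank_natr_inj yx'].
  by have := asym _ _ exy; rewrite xy' yx' exy'.
have -> : range (fun x => stereo_inv (p x)) `|`
    \bigcup_(xy in [set xy : V * V | e xy.1 xy.2])
      edge_curve (fun x y t => stereo_inv (segment (p x) (p y) t)) xy.1 xy.2 =
    @stereo_inv R 3 @` (range p `|`
      \bigcup_(xy in [set xy : V * V | e xy.1 xy.2])
        segment (p xy.1) (p xy.2) @` `[0, 1]).
  rewrite image_setU image_bigcup image_comp; congr (_ `|` _).
  by apply: eq_bigcupr => xy _; rewrite image_comp.
by apply: tame_stereo_inv; exact: polyhedron_segments.
Qed.

(** * Counting vertices on disjoint cycles *)

(** A cycle of length 1 is a loop and one of length 2 is a pair of opposite edges. *)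
Lemma directed_cycle_size (V : finType) (e : rel V) (c : seq V) :
  (forall x y, e x y -> ~~ e y x) -> directed_cycle e c -> (2 < size c)%N.
Proof.
move=> asym [+ /andP[+ _]].
case: c => [|x [|y [|z c]]] //= _; rewrite ?andbT.
  by move=> exx; have := asym _ _ exx; rewrite exx.
by move=> /andP[exy eyx]; have := asym _ _ exy; rewrite eyx.
Qed.

(** Concatenating the cycles gives a list of vertices without repetition, hence of length at most
    [#|V|]. *)
Lemma size_disjoint_cycles (V : finType) (s : seq (seq V)) (k : nat) :
  (forall c, c \in s -> uniq c /\ (k <= size c)%N) ->
  pairwise (@disjoint_cycles V) s -> (k * size s <= #|V|)%N.
Proof.
move=> s_large s_disj.
suff [uniq_s size_s] : uniq (flatten s) /\ (k * size s <= size (flatten s))%N.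
  by rewrite (leq_trans size_s) // -(card_uniqP uniq_s) max_card.
elim: s s_large s_disj => [|c s IHs] /= s_large; first by rewrite muln0.
move=> /andP[/allP c_disj /IHs[d|uniq_s size_s]].
  by move=> ds; apply: s_large; rewrite inE ds orbT.
have [uniq_c size_c] := s_large c (mem_head _ _).
rewrite size_cat mulnS leq_add // cat_uniq uniq_c uniq_s andbT; split=> //.
apply/hasPn => x /flattenP[d ds xd].
by have /hasPn/(_ x xd) := c_disj d ds.
Qed.

Local Close Scope ring_scope.
Local Close Scope classical_set_scope.

Theorem proposition9p1 (R : realType) (V : finType) (e : rel V)
    (card_V : #|V| = 11) (tournament_e : tournament e) :
  ~ disjoint_linking_property R e.
Proof.
have asym x y : e x y -> ~~ e y x.
  move=> exy; have [irr_e tot_e] := tournament_e.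
  have xy : x != y by apply: contraTneq exy => ->; rewrite irr_e.
  by have := tot_e _ _ xy; rewrite exy.
have [f] := embedding_exists R asym.
move=> /(_ f) [L1 [L2 [cyc disj [s1 s2] _ _]]].
have /(_ 3) := size_disjoint_cycles _ disj.
rewrite card_V size_cat leqNgt => /(_ _)/negP; apply => [c cL|].
  split; last exact: (directed_cycle_size asym (cyc _ cL)).
  by have [_ /andP[]] := cyc _ cL.
(* Here 3 * (2 + 2) = 12 exceeds 11. *)
by rewrite (leq_trans _ (leq_mul (leqnn 3) (leq_add s1 s2))).
Qed.
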